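(* For every positive integer $k$, any $\frac19$-tester (adaptive allowed) for convexity of functions $f\colon[3^k]\to[(9k)^{3k}]$ makes $\Omega(k)$ queries.
   Context: $[m]=\{0,\dots,m-1\}$. A function $f\colon X\to\mathbb{R}$ on a finite set $X\subseteq\mathbb{R}$ is convex if for every finite collection $x_1,\dots,x_k\in X$ and reals $\lambda_i\ge0$ with $\sum_i\lambda_i=1$ and $\sum_i\lambda_ix_i\in X$, one has $f(\sum_i\lambda_ix_i)\le\sum_i\lambda_if(x_i)$. $f$ is $\epsilon$-far from convex if every convex $h$ on the same domain differs from $f$ on at least $\epsilon|X|$ points. An $\epsilon$-tester is a randomized query algorithm that accepts convex functions with probability at least $2/3$ and rejects $\epsilon$-far functions with probability at least $2/3$. *)

(* Defs.v *)
From HB Require Import structures.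
From mathcomp Require Import all_boot all_order all_algebra.
From mathcomp Require Import Rstruct.
From Stdlib Require Rdefinitions.
Notation R := Rdefinitions.R.
Set Implicit Arguments. Unset Strict Implicit. Unset Printing Implicit Defensive.
Import Order.TTheory GRing.Theory Num.Theory.
Local Open Scope ring_scope.

(* Domain [n] = {0,...,n-1} is 'I_n, viewed inside the reals via (x : nat)%:R. *)

Definition convex_on (n : nat) (g : 'I_n -> R) : Prop :=
  forall (s : nat) (x : 'I_s -> 'I_n) (lam : 'I_s -> R) (y : 'I_n),
    (forall i, 0 <= lam i) ->
    \sum_(i < s) lam i = 1 ->
    (y : nat)%:R = \sum_(i < s) lam i * (x i : nat)%:R ->
    g y <= \sum_(i < s) lam i * g (x i).

Definition far_from_convex (n : nat) (eps : R) (f : 'I_n -> R) : Prop :=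
  forall h : 'I_n -> R, convex_on h ->
    eps * n%:R <= (#|[set x : 'I_n | h x != f x]|)%:R.

(* Deterministic adaptive query algorithms (decision trees) querying a
   function 'I_n -> 'I_m: a leaf outputs accept (true) / reject (false);
   an internal node queries a point and branches on the answer. *)
Inductive qtree (n m : nat) : Type :=
| QLeaf : bool -> qtree n m
| QNode : 'I_n -> ('I_m -> qtree n m) -> qtree n m.
Arguments QLeaf {n m}.
Arguments QNode {n m}.

Fixpoint qrun (n m : nat) (t : qtree n m) (f : 'I_n -> 'I_m) : bool :=
  match t with
  | QLeaf b => b
  | QNode x ch => qrun (ch (f x)) f
  end.

Fixpoint qdepth_le (n m : nat) (t : qtree n m) (q : nat) : Prop :=
  match t with
  | QLeaf _ => True
  | QNode _ ch => match q with
                  | 0 => False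
                  | q'.+1 => forall y, qdepth_le (ch y) q'
                  end
  end.

(* A randomized (adaptive) query algorithm: a probability distribution
   (weights w, nonnegative, summing to 1) over finitely many deterministic
   decision trees A i.  (Since there are only finitely many decision trees
   of bounded depth over finite domain and range, this is fully general.) *)
Record rtester (n m : nat) : Type := RTester {
  rt_size : nat;
  rt_w : 'I_rt_size -> R;
  rt_alg : 'I_rt_size -> qtree n m }.
Arguments rt_size {n m} r : rename.
Arguments rt_w {n m} r i : rename.
Arguments rt_alg {n m} r i : rename.

Definition is_distribution (n m : nat) (T : rtester n m) : Prop :=
  (forall i, 0 <= rt_w T i) /\ \sum_(i < rt_size T) rt_w T i = 1.

Definition accept_prob (n m : nat) (T : rtester n m) (f : 'I_n -> 'I_m) : R :=
  \sum_(i < rt_size T) rt_w T i * (qrun (rt_alg T i) f)%:R.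

Definition makes_at_most (n m : nat) (T : rtester n m) (q : nat) : Prop :=
  forall i, qdepth_le (rt_alg T i) q.

Definition realf (n m : nat) (f : 'I_n -> 'I_m) : 'I_n -> R :=
  fun x => (f x : nat)%:R.

Definition is_convexity_tester (n m : nat) (eps : R) (T : rtester n m) : Prop :=
  is_distribution T /\
  (forall f : 'I_n -> 'I_m, convex_on (realf f) -> 2 / 3 <= accept_prob T f) /\
  (forall f : 'I_n -> 'I_m, far_from_convex eps (realf f) ->
     1 - accept_prob T f >= 2 / 3).

(* Main.v *)
Require Import Defs.
From HB Require Import structures.
From mathcomp Require Import all_boot all_order all_algebra.
From mathcomp Require Import Rstruct.
From mathcomp Require Import zify ring lra.
Import Order.TTheory GRing.Theory Num.Theory.
Set Implicit Arguments. Unset Strict Implicit. Unset Printing Implicit Defensive.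
Local Open Scope ring_scope.

(** View [0, 3^k) as the leaves of a ternary tree. A block of length 3^(l+1)
    carries a piecewise linear convex valley with slopes -1, 0, 1 on its three
    thirds, vanishing at both ends, scaled by (3k)^l times a random integer in
    [1, k]. The weights make the sum over all blocks convex. If, for one level,
    the random integer is lowered by one on the central ninth of every block of
    that level, then each point of these ninths lies above the chord of its two
    translates in the neighbouring ninths: this gives n/9 disjoint violated
    midpoint inequalities, so the function is 1/9-far from convex.

    A query algorithm can notice the change at a level only if two of its
    queries separate at that level or the next lower one, since otherwise all
    queries in a block see either only lowered or only unlowered values. As q
    points separate at fewer than q levels, a random level escapes with
    probability 1 - O(q/k). For such a level, incrementing the random integers of
    the touched central ninths maps the convex functions injectively to far
    functions with the same run, except when one of these integers is already
    maximal, which has probability at most q/k. *)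

(** * Query paths of decision trees *)

Fixpoint qpath (n m : nat) (t : qtree n m) (f : 'I_n -> 'I_m) : seq 'I_n :=
  if t is QNode x ch then x :: qpath (ch (f x)) f else [::].

Lemma size_qpath (n m q : nat) (t : qtree n m) f :
  qdepth_le t q -> (size (qpath t f) <= q)%N.
Proof.
by elim: t q => [b|x ch IH] [|q] //= Hd; rewrite ltnS; exact: IH.
Qed.

Lemma eq_qpath (n m : nat) (t : qtree n m) f g :
  {in qpath t f, f =1 g} -> qpath t g = qpath t f.
Proof.
elim: t => [b|x ch IH] //= fg.
have fgx : f x = g x by apply: fg; rewrite mem_head.
by rewrite -fgx IH // => y yP; apply: fg; rewrite inE yP orbT.
Qed.

Lemma eq_qrun (n m : nat) (t : qtree n m) f g :
  {in qpath t f, f =1 g} -> qrun t g = qrun t f.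
Proof.
elim: t => [b|x ch IH] //= fg.
have fgx : f x = g x by apply: fg; rewrite mem_head.
by rewrite -fgx IH // => y yP; apply: fg; rewrite inE yP orbT.
Qed.

(** The first [s] answers determine the next query, so agreement on [s] queries fixes one more entry
    of the path. *)
Lemma eq_take_qpath (n m s : nat) (t : qtree n m) f g :
  {in take s (qpath t f), f =1 g} ->
  take s.+1 (qpath t g) = take s.+1 (qpath t f).
Proof.
elim: t s => [b|x ch IH] [|s] fg //; first by rewrite /= !take0.
have fgx : f x = g x by apply: fg; rewrite /= mem_head.
rewrite [LHS]/= [RHS]/= -fgx; congr cons.
by apply: IH => y yP; apply: fg; rewrite /= inE yP orbT.
Qed.

Definition ffun_upd (P V : finType) (o : {ffun P -> V}) (p : P) (v : V) :=
  [ffun p' => if p' == p then v else o p'].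

(* Before a query first reads coordinate [p], the run does not depend on the
   value there, so that value may be resampled without changing the query. *)
Lemma card_qpath_hits (n m q : nat) (P V : finType)
    (F : {ffun P -> V} -> 'I_n -> 'I_m) (c : 'I_n -> P) (v0 : V)
    (t : qtree n m) :
  (forall o y v x, c x != c y -> F (ffun_upd o (c y) v) x = F o x) ->
  qdepth_le t q ->
  (#|[set o : {ffun P -> V} | has (fun x => o (c x) == v0) (qpath t (F o))]| * #|V|
     <= q * #|{ffun P -> V}|)%N.
Proof.
move=> locF tq.
pose a (o : {ffun P -> V}) x := o (c x) == v0.
(* Sort the parameters by the index [s] of the first query that reads [v0]. *)
pose B (s : 'I_q) :=
  [set o : {ffun P -> V} | has (a o) (qpath t (F o)) & find (a o) (qpath t (F o)) == s].
have cardB s : (#|B s| * #|V| <= #|{ffun P -> V}|)%N.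
  have [->|[o0]] := set_0Vmem (B s); first by rewrite cards0.
  rewrite inE => /andP[]; case/hasP => x0 _ _ _.
  pose cell o := c (nth x0 (qpath t (F o)) s).
  rewrite -cardsT -cardsX.
  (* Resampling the value read at time [s] is injective on [B s] times [V]: the image still shows
     the cell and the new value, and the old value was [v0]. *)
  pose g (ov : {ffun P -> V} * V) := ffun_upd ov.1 (cell ov.1) ov.2.
  rewrite -(card_in_imset (f := g)) ?max_card //.
  have key o v : o \in B s ->
      o (cell o) = v0 /\ cell (g (o, v)) = cell o.
    rewrite inE => /andP[hP /eqP fP]; split.
      by have := nth_find x0 hP; rewrite fP => /eqP.
    have sP : (s < size (qpath t (F o)))%N by rewrite -fP -has_find.
    rewrite /cell; congr (c _).
    rewrite -(nth_take x0 (ltnSn s)) (@eq_take_qpath _ _ s t (F o)) ?nth_take//.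
    (* An earlier query of the same cell would have read [v0] before time [s]. *)
    move=> x xs; rewrite /g locF //; apply/eqP => cx.
    have [j js jx] := nthP x0 xs.
    rewrite size_take sP in js.
    rewrite nth_take // in jx.
    have := @before_find _ x0 (a o) (qpath t (F o)) j.
    rewrite fP js => /(_ isT); rewrite jx /a cx.
    have := nth_find x0 hP; rewrite fP /a => /eqP ->.
    by rewrite eqxx.
  move=> [o1 v1] [o2 v2]; rewrite !inE /= !andbT => B1 B2 eg.
  have {}B1 : o1 \in B s by rewrite inE.
  have {}B2 : o2 \in B s by rewrite inE.
  have [z1 c1] := key o1 v1 B1; have [z2 c2] := key o2 v2 B2.
  have cc : cell o1 = cell o2 by rewrite -c1 eg c2.
  have eo p : g (o1, v1) p = g (o2, v2) p by rewrite eg.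
  congr pair; last first.
    by have := eo (cell o1); rewrite !ffunE -cc eqxx.
  apply/ffunP => p; have := eo p; rewrite !ffunE -cc.
  by case: eqP => // ->; rewrite z1 cc z2.
set bad := [set o | _].
have sub : bad \subset \bigcup_(s < q) B s.
  apply/subsetP => o; rewrite inE => hP.
  have sP : (find (a o) (qpath t (F o)) < q)%N.
    by rewrite (leq_trans _ (size_qpath (F o) tq)) // -has_find.
  by apply/bigcupP; exists (Ordinal sP); rewrite ?inE ?hP /=.
have le1 : (#|bad| <= \sum_(s < q) #|B s|)%N.
  apply: leq_trans (subset_leq_card sub) _.
  elim/big_rec2: _ => [|s y x _ IH]; first by rewrite cards0.
  by rewrite (leq_trans (leq_card_setU _ _)) // leq_add2l.
apply: (@leq_trans ((\sum_(s < q) #|B s|) * #|V|)); first by rewrite leq_mul2r le1 orbT.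
rewrite big_distrl /= -[q in (_ <= q * _)%N]card_ord -sum_nat_const.
by apply: leq_sum => s _; exact: cardB.
Qed.

(** * Levels at which query points separate *)

Definition branches (i x y : nat) :=
  (x %/ 3 ^ i.+1 == y %/ 3 ^ i.+1)%N && (x %/ 3 ^ i != y %/ 3 ^ i)%N.

Lemma eq_div_exp_leq (i j x y : nat) : (i <= j)%N ->
  (x %/ 3 ^ i = y %/ 3 ^ i)%N -> (x %/ 3 ^ j = y %/ 3 ^ j)%N.
Proof. by move=> /subnKC <- e; rewrite expnD !divnMA e. Qed.

(** A new point [x] adds at most one level: [3 ^ j0] is the smallest block length at which it shares
    a block with some [y0] of [S], and from level [j0] on [y0] can replace [x]. *)
Lemma branch_levels (S : seq nat) : exists2 s : seq nat, (size s <= size S)%N &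
  forall i x y, x \in S -> y \in S -> branches i x y -> i \in s.
Proof.
elim: S => [|x S [s szs Hs]]; first by exists [::].
have [/nilP -> | Sn] := boolP (nilp S).
  exists [::] => // i y z; rewrite !inE => /eqP -> /eqP ->.
  by rewrite /branches !eqxx.
pose P j := has (fun y => x %/ 3 ^ j == y %/ 3 ^ j)%N S.
have exP : exists j, P j.
  case: S Sn {Hs szs} @P => // y S _; exists (x + y)%N => /=.
  have lt3 z : (z < 3 ^ z)%N by apply: ltn_expl.
  rewrite !divn_small ?eqxx //.
    by apply: leq_trans (lt3 y) _; rewrite leq_exp2l // leq_addl.
  by apply: leq_trans (lt3 x) _; rewrite leq_exp2l // leq_addr.
have [j0 /hasP[y0 y0S /eqP e0] minj] := ex_minnP exP.
have new i y : y \in S -> branches i x y -> i \in j0.-1 :: s.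
  move=> yS /andP[/eqP e1 n1].
  have lej : (j0 <= i.+1)%N by apply: minj; apply/hasP; exists y => //; apply/eqP.
  have [lj|gj] := leqP j0 i; last first.
    by rewrite inE; apply/orP; left; apply/eqP; lia.
  rewrite inE; apply/orP; right; apply: (Hs i y0 y) => //.
  rewrite /branches -(eq_div_exp_leq lj e0) n1 andbT -e1.
  by apply/eqP; symmetry; apply: eq_div_exp_leq lej e0.
exists (j0.-1 :: s) => // i y z; rewrite !(inE, in_cons).
case/orP => [/eqP ->|yS]; case/orP => [/eqP ->|zS].
- by rewrite /branches !eqxx.
- by move=> /(new i z zS); rewrite inE.
- rewrite /branches eq_sym (eq_sym (y %/ 3 ^ i)%N).
  by move=> /(new i y yS); rewrite inE.
- by move=> b; rewrite (Hs i y z) ?orbT.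
Qed.

(** * Criteria for convexity *)

(** The supporting line at [y], averaged over the points [x i], returns [f y]. *)
Lemma convex_on_support (n : nat) (f s : 'I_n -> R) :
  (forall x y : 'I_n, f y + s y * ((x : nat)%:R - (y : nat)%:R) <= f x) -> convex_on f.
Proof.
move=> supp p x lam y lam0 lam1 ey.
apply: (@le_trans _ _
  (\sum_(i < p) lam i * (f y + s y * ((x i : nat)%:R - (y : nat)%:R)))); last first.
  by apply: ler_sum => i _; apply: ler_wpM2l.
rewrite (eq_bigr (fun i => lam i * (f y - s y * (y : nat)%:R)
                           + s y * (lam i * (x i : nat)%:R))); last by move=> i _; ring.
rewrite big_split /= -mulr_suml lam1 -mulr_sumr -ey; lra.
Qed.

Lemma convex_on_midpoint (n : nat) (h : 'I_n -> R) (a b c : 'I_n) :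
  convex_on h -> (b + b = a + c)%N -> h b + h b <= h a + h c.
Proof.
move=> hc e.
have := hc 2%N (fun i : 'I_2 => if i == 0 then a else c) (fun=> 1 / 2) b.
rewrite !big_ord_recl !big_ord0 /= => H.
have {}H : h b <= 1 / 2 * h a + (1 / 2 * h c + 0).
  apply: H => [i||]; [lra|lra|].
  have : ((b + b)%N%:R : R) = (a + c)%N%:R by rewrite e.
  by rewrite !natrD; lra.
lra.
Qed.

(** Nondecreasing increments yield supporting lines. Slopes are compared only below [n], since those
    of the hills can drop at [3 ^ k]. *)
Lemma support_of_slopes (n : nat) (g s : nat -> R) :
  (forall x, g x.+1 = g x + s x) ->
  (forall x, (x.+1 < n)%N -> s x <= s x.+1) ->
  forall x y, (x < n)%N -> (y < n)%N -> g y + s y * (x%:R - y%:R) <= g x.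
Proof.
move=> gS sS.
have mono y d : (y + d < n)%N -> s y <= s (y + d)%N.
  elim: d => [|d IH]; rewrite ?addn0 // addnS => yd.
  by apply: le_trans (IH (ltnW yd)) (sS _ yd).
move=> x y xn yn; have [le_yx|/ltnW le_xy] := leqP y x.
  rewrite -(subnKC le_yx) in xn *; move: (x - y)%N xn => d.
  elim: d => [|d IH]; rewrite ?addn0 ?subrr ?mulr0 ?addr0 // addnS => yd.
  have := IH (ltnW yd); have := mono y d (ltnW yd).
  by rewrite gS -natr1 natrD; lra.
rewrite -(subnKC le_xy) in yn *; move: (y - x)%N yn => d.
elim: d => [|d IH]; rewrite ?addn0 ?subrr ?mulr0 ?addr0 // addnS => yd.
have := IH (ltnW yd); have := sS _ yd.
rewrite gS -natr1 natrD => h1 h2.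
have : 0 <= (s (x + d).+1 - s (x + d)%N) * (d%:R + 1).
  by rewrite mulr_ge0 ?subr_ge0 // addr_ge0.
nra.
Qed.

(** * Sums of scaled tents and convexity of the hills *)

Definition digit (l x : nat) : nat := (x %/ 3 ^ l %% 3)%N.

(** The valley turned upside down, so that values stay in [nat]; [hill] restores the sign. *)
Definition tent (l x : nat) : nat :=
  if digit l x == 0 then (x %% 3 ^ l)%N
  else if digit l x == 1 then (3 ^ l)%N else (3 ^ l - x %% 3 ^ l)%N.

Lemma tent_le (l x : nat) : (tent l x <= 3 ^ l)%N.
Proof.
rewrite /tent; case: ifP => _; first by rewrite ltnW // ltn_pmod // expn_gt0.
by case: ifP => _; rewrite ?leq_subr.
Qed.

(** The increment is [1 - digit l x], written without subtraction. In the second case [x.+1] starts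
    a new block: the tent vanishes there, so a change of multiplier does not spoil [depthS]. *)
Lemma tentS (l x : nat) :
  (x.+1 %/ 3 ^ l.+1 = x %/ 3 ^ l.+1 /\ tent l x.+1 + digit l x = tent l x + 1)%N
  \/ [/\ tent l x.+1 = 0, digit l x = 2 & tent l x = 1]%N.
Proof.
rewrite expnSr !divnMA /tent /digit.
have L0 : (0 < 3 ^ l)%N by rewrite expn_gt0.
have ex := divn_eq x (3 ^ l).
have yL : (x %% 3 ^ l < 3 ^ l)%N by rewrite ltn_pmod.
move: (3 ^ l)%N (x %/ 3 ^ l)%N (x %% 3 ^ l)%N L0 ex yL => L q y L0 -> yL.
have [yL'|yL'] := ltnP y.+1 L.
  have -> : ((q * L + y).+1 %/ L = q)%N by rewrite -addnS divnMDl // divn_small ?addn0.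
  have -> : ((q * L + y).+1 %% L = y.+1)%N by rewrite -addnS modnMDl modn_small.
  left; split => //; have := ltn_pmod q (isT : 0 < 3)%N.
  by case: (q %% 3)%N => [|[|[|]]] //= _; lia.
have -> : ((q * L + y).+1 = q.+1 * L)%N by lia.
rewrite mulnK // modnMl.
have := ltn_pmod q (isT : 0 < 3)%N; have eq := divn_eq q 3.
case e : (q %% 3)%N => [|[|[|]]] //= _; [left|left|right].
- have -> : (q.+1 %% 3 = 1)%N by lia.
  by split => /=; lia.
- have -> : (q.+1 %% 3 = 2)%N by lia.
  by split => /=; lia.
- have -> : (q.+1 %% 3 = 0)%N by lia.
  by split => /=; lia.
Qed.

(** The tent is affine on each third of its block. *)
Lemma tent_midpoint (l a d : nat) :
  (a %/ 3 ^ l = (a + d) %/ 3 ^ l)%N -> ((a + d + d) %/ 3 ^ l = (a + d) %/ 3 ^ l)%N ->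
  (tent l a + tent l (a + d + d) = tent l (a + d) + tent l (a + d))%N.
Proof.
move=> e1 e2; rewrite /tent /digit e1 e2.
have := divn_eq a (3 ^ l); have := divn_eq (a + d) (3 ^ l).
have := divn_eq (a + d + d) (3 ^ l); rewrite e1 e2.
have pl x : (x %% 3 ^ l < 3 ^ l)%N by rewrite ltn_pmod // expn_gt0.
have := pl a; have := pl (a + d)%N; have := pl (a + d + d)%N.
move: (3 ^ l)%N (a %% 3 ^ l)%N ((a + d) %% 3 ^ l)%N ((a + d + d) %% 3 ^ l)%N
  ((a + d) %/ 3 ^ l * 3 ^ l)%N ((a + d) %/ 3 ^ l %% 3)%N.
by clear=> L ra rb rc Q u; case: ifP => _; [|case: ifP => _]; lia.
Qed.

Definition depth (M K : nat) (m : nat -> nat -> nat) (x : nat) : nat :=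
  \sum_(0 <= l < K) (3 * M) ^ l * m l x * tent l x.

Definition depth_max (M K : nat) : nat :=
  \sum_(0 <= l < K) (3 * M) ^ l * M * 3 ^ l.

(* [m l x] scales the tent on the block of length [3 ^ l.+1] containing [x]. *)
Definition multiplier (M : nat) (m : nat -> nat -> nat) :=
  (forall l x, 0 < m l x <= M)%N /\
  (forall l x y, x %/ 3 ^ l.+1 = y %/ 3 ^ l.+1 -> m l x = m l y)%N.

Lemma depth_le (M K : nat) m x :
  (forall l x, m l x <= M)%N -> (depth M K m x <= depth_max M K)%N.
Proof.
by move=> mM; apply: leq_sum => l _; rewrite leq_mul ?tent_le // leq_mul.
Qed.

(** A geometric sum of ratio [9 * M]. It bounds the range of the functions and, with a level for
    [K], the contribution of all lower levels. *)
Lemma depth_max_lt (M K : nat) : (0 < M)%N ->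
  (depth_max M K < (3 * M) ^ K * 3 ^ K)%N.
Proof.
move=> M0; rewrite /depth_max; elim: K => [|K IH]; first by rewrite big_nil.
rewrite big_nat_recr //= !expnS.
by move: ((3 * M) ^ K)%N (3 ^ K)%N (\sum_(_ <= _ < _) _)%N IH; nia.
Qed.

(** For a multiplier [m], the forward difference of minus [depth], hence of the hill. *)
Definition slope (M K : nat) (m : nat -> nat -> nat) (x : nat) : R :=
  \sum_(0 <= l < K) ((3 * M) ^ l * m l x)%N%:R * ((digit l x)%:R - 1).

Lemma depthS (M K : nat) m x : multiplier M m ->
  (depth M K m x)%:R = (depth M K m x.+1)%:R + slope M K m x.
Proof.
move=> [_ mb]; rewrite /depth /slope !natr_sum -big_split /=.
apply: eq_bigr => l _; rewrite !natrM.
have [[e1 e2]|[-> -> ->]] := tentS l x; last by lra.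
rewrite (mb _ _ _ e1).
have : ((tent l x.+1 + digit l x)%N%:R : R) = (tent l x + 1)%N%:R by rewrite e2.
rewrite !natrD => e3; have -> : ((tent l x)%:R : R) = (tent l x.+1)%:R + ((digit l x)%:R - 1) by lra.
by ring.
Qed.

(** The levels below [K] can lower the slope by at most the left side, which a unit step of the
    digit at level [K] compensates. *)
Lemma geometric_gap (M K : nat) : (0 < M)%N ->
  (2 * M * \sum_(0 <= l < K) (3 * M) ^ l <= (3 * M) ^ K)%N.
Proof.
move=> M0; elim: K => [|K IH]; first by rewrite big_nil muln0.
rewrite big_nat_recr //= !expnS.
by move: ((3 * M) ^ K)%N (\sum_(_ <= _ < _) _)%N IH; nia.
Qed.

Lemma slope_norm (M K : nat) m x : multiplier M m ->
  `|slope M K m x| <= (M * \sum_(0 <= l < K) (3 * M) ^ l)%N%:R.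
Proof.
move=> [mM _]; rewrite natrM natr_sum mulr_sumr.
apply: (le_trans (ler_norm_sum _ _ _)); apply: ler_sum => l _.
rewrite normrM normr_nat natrM -mulrA mulrC ler_wpM2r //.
have /andP[_ mlM] := mM l x.
have d1 : `|(digit l x)%:R - 1 : R| <= 1.
  have := ltn_pmod (x %/ 3 ^ l)%N (isT : 0 < 3)%N; rewrite -/(digit l x).
  by case: (digit l x) => [|[|[|]]] //= _; rewrite ler_norml; apply/andP; split; lra.
apply: (@le_trans _ _ ((m l x)%:R * 1)); first by rewrite ler_wpM2l.
by rewrite mulr1 ler_nat.
Qed.

Lemma divS_ndvd (d x : nat) : (0 < d)%N -> ~~ (d %| x.+1)%N -> (x.+1 %/ d = x %/ d)%N.
Proof.
move=> d0 nd; have ex := divn_eq x d; have := ltn_pmod x d0.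
rewrite leq_eqVlt => /orP[/eqP e|lt]; last first.
  by rewrite {1}ex -addnS divnMDl // (divn_small lt) addn0.
by case/negP: nd; rewrite ex -addnS e -mulSnr dvdn_mull.
Qed.

(** At the highest level where the digit changes, it goes up by one within the same block, and by
    [geometric_gap] this outweighs the changes below. *)
Lemma slope_nondecreasing (M K : nat) m x : (0 < M)%N -> multiplier M m ->
  ~~ (3 ^ K %| x.+1)%N -> slope M K m x <= slope M K m x.+1.
Proof.
move=> M0 mm; elim: K => [|K IH]; first by rewrite expn0 dvd1n.
move=> nd; rewrite /slope !big_nat_recr //= -/(slope M K m x) -/(slope M K m x.+1).
have eb : (x.+1 %/ 3 ^ K.+1 = x %/ 3 ^ K.+1)%N by rewrite divS_ndvd // expn_gt0.
have [dv|ndK] := boolP (3 ^ K %| x.+1)%N; last first.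
  rewrite lerD ?IH // (mm.2 _ _ _ eb) /digit divS_ndvd ?expn_gt0 //.
(* The digit does not wrap from 2 to 0, as [3 ^ K.+1] does not divide [x.+1]. *)
have ed : digit K x.+1 = (digit K x).+1.
  have L0 : (0 < 3 ^ K)%N by rewrite expn_gt0.
  rewrite /digit; case/dvdnP: dv nd => -[|q] eq; first by rewrite mul0n in eq.
  rewrite eq expnS dvdn_pmul2r // mulnK // => nq.
  have -> : (x = q * 3 ^ K + (3 ^ K).-1)%N by move: eq; rewrite mulSn; lia.
  rewrite divnMDl // [((3 ^ K).-1 %/ _)%N]divn_small ?addn0; last by rewrite prednK.
  by move: nq; lia.
rewrite (mm.2 _ _ _ eb) ed -natr1.
have /andP[mg0 _] := mm.1 K x.
have h1 : ((3 * M) ^ K)%N%:R <= ((3 * M) ^ K * m K x)%N%:R :> R.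
  by rewrite ler_nat leq_pmulr.
have := slope_norm K x mm; have := slope_norm K x.+1 mm.
rewrite !ler_norml => /andP[h2 _] /andP[_ h3].
have := geometric_gap K M0; rewrite -(ler_nat R) -mulnA natrM => h4.
by lra.
Qed.

Definition hill (M k r : nat) (hr : (depth_max M k < r)%N) (m : nat -> nat -> nat)
    (x : 'I_(3 ^ k)) : 'I_r :=
  Ordinal (leq_ltn_trans (leq_subr (depth M k m x) (depth_max M k)) hr).

Lemma realf_hill (M k r : nat) (hr : (depth_max M k < r)%N) m x :
  (forall l x, m l x <= M)%N ->
  realf (hill hr m) x = (depth_max M k)%:R - (depth M k m x)%:R.
Proof. by move=> mM; rewrite /realf /= natrB // depth_le. Qed.

Lemma convex_hill (M k r : nat) (hr : (depth_max M k < r)%N) m :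
  (0 < M)%N -> multiplier M m -> convex_on (realf (hill hr m)).
Proof.
move=> M0 mm.
have mM l x : (m l x <= M)%N by have /andP[] := mm.1 l x.
apply: (@convex_on_support _ _ (fun x => slope M k m x)) => x y.
rewrite !realf_hill //.
apply: (support_of_slopes (n := 3 ^ k)
  (g := fun x => (depth_max M k)%:R - (depth M k m x)%:R)) => // {x y} x.
  by rewrite (depthS k x mm); lra.
by move=> xn; apply: slope_nondecreasing => //; rewrite gtnNdvd.
Qed.

(** * Dented functions are far from convex *)

Definition core (i x : nat) : bool := (digit i.+1 x == 1)%N && (digit i x == 1)%N.

(* [core i] is the central ninth of the blocks of level [i.+1]. The truncated
   subtraction is harmless, as multipliers are positive. *)
Definition dent (i : nat) (m : nat -> nat -> nat) (l x : nat) : nat :=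
  (m l x - ((l == i.+1) && core i x))%N.

(** The points lie in the three ninths of the central third of one block. Higher levels are affine
    there and the tent of level [i.+1] is constant, so the dent costs the middle point
    [(3 * M) ^ i.+1 * 3 ^ i.+1], more than all lower levels can give it. *)
Lemma dent_violation (M k i w z : nat) m (a := (w * 3 ^ i.+2 + 3 ^ i.+1 + z)%N) :
  (0 < M)%N -> multiplier M m -> (i.+1 < k)%N -> (z < 3 ^ i)%N ->
  (depth M k (dent i m) (a + 3 ^ i) + depth M k (dent i m) (a + 3 ^ i)
   < depth M k (dent i m) a + depth M k (dent i m) (a + 3 ^ i + 3 ^ i))%N.
Proof.
move=> M0 mm ik zi.
have L0 : (0 < 3 ^ i)%N by rewrite expn_gt0.
have E1 : (3 ^ i.+1 = 3 * 3 ^ i)%N by rewrite expnS.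
have E2 : (3 ^ i.+2 = 9 * 3 ^ i)%N by rewrite !expnS mulnA.
set b := (a + 3 ^ i)%N; set c := (b + 3 ^ i)%N.
(* Digit 1 at level [i.+1], and digit [j] at level [i]. *)
have di j : (j < 3)%N -> ((a + j * 3 ^ i) %/ 3 ^ i = w * 9 + 3 + j)%N.
  move=> _; have -> : (a + j * 3 ^ i = (w * 9 + 3 + j) * 3 ^ i + z)%N.
    by rewrite /a E1 E2; lia.
  by rewrite divnMDl // divn_small ?addn0.
have ea : (a = a + 0 * 3 ^ i)%N by lia.
have eb : (b = a + 1 * 3 ^ i)%N by rewrite /b; lia.
have ec : (c = a + 2 * 3 ^ i)%N by rewrite /c /b; lia.
have da : (a %/ 3 ^ i = w * 9 + 3)%N by rewrite ea di ?addn0.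
have db : (b %/ 3 ^ i = w * 9 + 4)%N by rewrite eb di // -addnA.
have dc : (c %/ 3 ^ i = w * 9 + 5)%N by rewrite ec di // -addnA.
have ab : (a %/ 3 ^ i.+1 = b %/ 3 ^ i.+1)%N by rewrite expnSr !divnMA da db; clear; lia.
have cb : (c %/ 3 ^ i.+1 = b %/ 3 ^ i.+1)%N by rewrite expnSr !divnMA dc db; clear; lia.
have b1 : (b %/ 3 ^ i.+1 = w * 3 + 1)%N by rewrite expnSr divnMA db; clear; lia.
have tent1 x : (x %/ 3 ^ i.+1 = b %/ 3 ^ i.+1)%N -> tent i.+1 x = (3 ^ i.+1)%N.
  by move=> e; rewrite /tent /digit e b1 modnMDl.
pose lo x := (\sum_(0 <= l < i.+1) (3 * M) ^ l * dent i m l x * tent l x)%N.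
pose hi x := (\sum_(i.+2 <= l < k) (3 * M) ^ l * dent i m l x * tent l x)%N.
have split x : depth M k (dent i m) x
    = (lo x + ((3 * M) ^ i.+1 * dent i m i.+1 x * tent i.+1 x + hi x))%N.
  by rewrite /depth /lo /hi (@big_cat_nat _ _ _ i.+1) ?(ltnW ik) //= (@big_ltn _ _ _ i.+1 k).
rewrite !split.
have hlo : (lo b < (3 * M) ^ i.+1 * 3 ^ i.+1)%N.
  apply: leq_ltn_trans (depth_max_lt i.+1 M0); apply: depth_le => l x.
  by rewrite (leq_trans (leq_subr _ _)) //; have /andP[] := mm.1 l x.
have hhi : (hi a + hi c = hi b + hi b)%N.
  rewrite /hi -!big_split /=; apply: eq_big_nat => l /andP[il lk].
  have nl x : dent i m l x = m l x by rewrite /dent gtn_eqF //= subn0.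
  rewrite !nl.
  have ab' := eq_div_exp_leq (ltnW il) ab; have cb' := eq_div_exp_leq (ltnW il) cb.
  have ll := leqW (ltnW il).
  rewrite (mm.2 _ _ _ (eq_div_exp_leq ll ab)) (mm.2 _ _ _ (eq_div_exp_leq ll cb)).
  rewrite -!mulnDr; congr muln.
  exact: tent_midpoint.
rewrite !tent1 // /dent eqxx /= /core /digit ab cb da db dc b1 !modnMDl /=.
have -> : ((w * 9 + 3) %% 3 == 1 = false)%N by clear; lia.
have -> : ((w * 9 + 4) %% 3 == 1)%N by clear; lia.
have -> : ((w * 9 + 5) %% 3 == 1 = false)%N by clear; lia.
rewrite /= !subn0.
rewrite (mm.2 _ _ _ (eq_div_exp_leq (leqnSn _) ab)) (mm.2 _ _ _ (eq_div_exp_leq (leqnSn _) cb)).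
have /andP[mb _] := mm.1 i.+1 b.
have -> : ((3 * M) ^ i.+1 * m i.+1 b * 3 ^ i.+1 =
        (3 * M) ^ i.+1 * (m i.+1 b - 1) * 3 ^ i.+1 + (3 * M) ^ i.+1 * 3 ^ i.+1)%N.
  by rewrite -[in LHS](subnK mb) mulnDr mulnDl muln1.
move: (lo a) (lo b) (lo c) (hi a) (hi b) (hi c) ((3 * M) ^ i.+1 * 3 ^ i.+1)%N
  ((3 * M) ^ i.+1 * (m i.+1 b - 1) * 3 ^ i.+1)%N hlo hhi.
by clear; lia.
Qed.

(** [rho] is constant on each violated triple and separates distinct triples. A convex [h] must
    change a point of every triple, so [rho] maps [D] onto all [3 ^ e * 3 ^ i] labels, a ninth of
    [3 ^ k]. *)
Lemma far_dent (M k r i : nat) (hr : (depth_max M k < r)%N) m :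
  (0 < M)%N -> multiplier M m -> (i.+1 < k)%N ->
  far_from_convex (1 / 9) (realf (hill hr (dent i m))).
Proof.
move=> M0 mm ik h hc.
set f := realf _; set D := [set x | _].
have [e ek] : exists e, k = (i + e.+2)%N by exists (k - i.+2)%N; lia.
have kE : (3 ^ k = 3 ^ e * 3 ^ i.+2)%N by rewrite -expnD; congr expn; lia.
have w_lt (x : 'I_(3 ^ k)) : (x %/ 3 ^ i.+2 < 3 ^ e)%N.
  by rewrite ltn_divLR ?expn_gt0 // -kE.
have z_lt (x : 'I_(3 ^ k)) : (x %% 3 ^ i < 3 ^ i)%N by rewrite ltn_pmod ?expn_gt0.
pose rho x := (Ordinal (w_lt x), Ordinal (z_lt x)).
have sub : [set: 'I_(3 ^ e) * 'I_(3 ^ i)] \subset rho @: D.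
  apply/subsetP => -[w z] _.
  pose a := (w * 3 ^ i.+2 + 3 ^ i.+1 + z)%N.
  have E1 : (3 ^ i.+1 = 3 * 3 ^ i)%N by rewrite expnS.
  have E2 : (3 ^ i.+2 = 9 * 3 ^ i)%N by rewrite !expnS mulnA.
  have zi := ltn_ord z; have wi := ltn_ord w.
  have pt j : (j < 3)%N -> (a + j * 3 ^ i < 3 ^ k)%N.
    move=> j3; rewrite kE /a.
    have : (w.+1 * 3 ^ i.+2 <= 3 ^ e * 3 ^ i.+2)%N by rewrite leq_mul2r wi orbT.
    by rewrite E1 E2; nia.
  have rhoE j (j3 : (j < 3)%N) : rho (Ordinal (pt j j3)) = (w, z).
    congr pair; apply: val_inj => /=.
      rewrite /a -!addnA divnMDl ?expn_gt0 // divn_small ?addn0 //.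
      by rewrite E1 E2; nia.
    have -> : (a + j * 3 ^ i = (w * 9 + 3 + j) * 3 ^ i + z)%N by rewrite /a E1 E2; lia.
    by rewrite modnMDl modn_small.
  pose A := Ordinal (pt 0%N isT); pose B := Ordinal (pt 1%N isT); pose C := Ordinal (pt 2%N isT).
  have [x xD rx] : exists2 x, x \in D & rho x = (w, z).
    have [AD|nA] := boolP (A \in D); first by exists A; [|exact: rhoE].
    have [BD|nB] := boolP (B \in D); first by exists B; [|exact: rhoE].
    have [CD|nC] := boolP (C \in D); first by exists C; [|exact: rhoE].
    move: nA nB nC; rewrite !inE !negbK => /eqP hA /eqP hB /eqP hC.
    have := convex_on_midpoint (a := A) (b := B) (c := C) hc.
    rewrite hA hB hC /= => /(_ ltac:(lia)).
    have mM l x : (dent i m l x <= M)%N.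
      by rewrite (leq_trans (leq_subr _ _)) //; have /andP[] := mm.1 l x.
    rewrite /f !realf_hill //=.
    have := dent_violation w M0 mm ik zi; rewrite -/a.
    have -> : (a + 0 * 3 ^ i = a)%N by lia.
    have -> : (a + 1 * 3 ^ i = a + 3 ^ i)%N by lia.
    have -> : (a + 2 * 3 ^ i = a + 3 ^ i + 3 ^ i)%N by lia.
    by rewrite -(ltr_nat R) !natrD; lra.
  by apply/imsetP; exists x.
have := leq_trans (subset_leq_card sub) (leq_imset_card _ _).
rewrite cardsT card_prod !card_ord -(ler_nat R) => le.
apply: le_trans le.
have -> : (3 ^ k = 9 * (3 ^ e * 3 ^ i))%N by rewrite kE !expnS; lia.
by rewrite [(9 * _)%N%:R]natrM; lra.
Qed.

(** * Random multipliers and the bumping map *)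

Definition cell (k l x : nat) : 'I_k.+1 * 'I_(3 ^ k).+1 :=
  (inord l, inord (x %/ 3 ^ l.+1)).

(* The spare coordinates allow [inord] and are never read. *)
Definition param (N : nat) : finType :=
  {ffun 'I_N.+2 * 'I_(3 ^ N.+1).+1 -> 'I_N.+1}.

Definition height (N : nat) (o : param N) (l x : nat) : nat :=
  (o (cell N.+1 l x)).+1.

Lemma multiplier_height (N : nat) (o : param N) : multiplier N.+1 (height o).
Proof.
split=> [l x|l x y e]; first by rewrite /height /= ltn_ord.
by rewrite /height /cell e.
Qed.

Lemma cell_neq (k l l' x y : nat) : (l <= k)%N -> (l' <= k)%N -> l != l' ->
  cell k l x != cell k l' y.
Proof.
move=> lk lk' nl; apply: contra nl.
by move=> /eqP /(congr1 fst) /(congr1 val) /=; rewrite !inordK // => ->.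
Qed.

Lemma cell_inj (k l : nat) (x y : 'I_(3 ^ k)) :
  cell k l x = cell k l y -> (x %/ 3 ^ l.+1 = y %/ 3 ^ l.+1)%N.
Proof.
have lt (z : 'I_(3 ^ k)) : (z %/ 3 ^ l.+1 < (3 ^ k).+1)%N.
  by rewrite ltnS (leq_trans (leq_div _ _)) // ltnW.
by move=> /(congr1 snd) /(congr1 val) /=; rewrite !inordK.
Qed.

Lemma eq_hill (M k r : nat) (hr : (depth_max M k < r)%N)
    (m m' : nat -> nat -> nat) (x : 'I_(3 ^ k)) :
  (forall l, (l < k)%N -> m l x = m' l x) -> hill hr m x = hill hr m' x.
Proof.
move=> e; apply: val_inj => /=; congr (_ - _)%N.
by apply: eq_big_nat => l /andP[_ lk]; rewrite e.
Qed.

Lemma ltn_ord_neq_max (N : nat) (v : 'I_N.+1) : v != ord_max -> (v.+1 < N.+1)%N.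
Proof. by rewrite -(inj_eq val_inj) /= ltnS ltn_neqAle => ->; rewrite -ltnS ltn_ord. Qed.

(** Raises exactly the blocks whose central ninth meets [S], to offset the dent there. At [ord_max]
    the [inord] would fall back to 0; [saturated] singles out that case. *)
Definition bump (N i : nat) (S : seq 'I_(3 ^ N.+1)) (o : param N) : param N :=
  [ffun p => if has (fun x : 'I_(3 ^ N.+1) => core i x && (p == cell N.+1 i.+1 x)) S
             then inord (o p).+1 else o p].

Definition branching (n i : nat) (S : seq 'I_n) : bool :=
  has (fun x : 'I_n => has (fun y : 'I_n => branches i x y) S) S.

Definition saturated (N i : nat) (S : seq 'I_(3 ^ N.+1)) (o : param N) : bool :=
  has (fun x : 'I_(3 ^ N.+1) => o (cell N.+1 i.+1 x) == ord_max) S.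

Lemma eq_of_not_branching (n i : nat) (S : seq 'I_n) (x y : 'I_n) :
  ~~ branching i S -> x \in S -> y \in S ->
  (x %/ 3 ^ i.+1 = y %/ 3 ^ i.+1)%N -> (x %/ 3 ^ i = y %/ 3 ^ i)%N.
Proof.
move=> nb xS yS e; apply/eqP; apply: contraR nb => ne.
by apply/hasP; exists x => //; apply/hasP; exists y => //; rewrite /branches e eqxx.
Qed.

(** If the block of [x] was bumped because of [y], the absence of branching at levels [i.+1] and [i]
    puts [x] in the central ninth with [y], so the dent cancels the bump. Otherwise [x] is outside
    that ninth, and neither acts. *)
Lemma dent_bump (N i : nat) (S : seq 'I_(3 ^ N.+1)) (o : param N)
    (x : 'I_(3 ^ N.+1)) (l : nat) :
  (i < N)%N -> ~~ branching i.+1 S -> ~~ branching i S -> ~~ saturated i S o ->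
  x \in S -> (l < N.+1)%N -> dent i (height (bump i S o)) l x = height o l x.
Proof.
move=> iN nb1 nb0 ns xS lN; rewrite /dent /height /bump ffunE.
have [el|nl] := eqVneq l i.+1; last first.
  rewrite subn0; case: hasP => // -[y _ /andP[_]].
  by rewrite (negbTE (cell_neq _ _ _ _ nl)) // ?ltnS; lia.
rewrite {}el; case: hasP => [[y yS /andP[cy /eqP /cell_inj exy]]|nx].
  have e1 := eq_of_not_branching nb1 xS yS exy.
  have e0 := eq_of_not_branching nb0 xS yS e1.
  have -> : core i x by move: cy; rewrite /core /digit e1 e0.
  rewrite inordK ?subn1 //.
  by rewrite ltn_ord_neq_max //; have /hasPn /(_ x xS) := ns.
case cx: (core i x); last by rewrite subn0.
by case: nx; exists x => //; rewrite cx eqxx.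
Qed.

Definition good (N r i : nat) (hr : (depth_max N.+1 N.+1 < r)%N)
    (t : qtree (3 ^ N.+1) r) (o : param N) : bool :=
  let S := qpath t (hill hr (height o)) in
  [&& ~~ branching i.+1 S, ~~ branching i S & ~~ saturated i S o].

Lemma hill_bump (N r i : nat) (hr : (depth_max N.+1 N.+1 < r)%N)
    (t : qtree (3 ^ N.+1) r) (o : param N)
    (S := qpath t (hill hr (height o))) :
  (i < N)%N -> good i hr t o ->
  {in S, hill hr (height o) =1 hill hr (dent i (height (bump i S o)))}.
Proof.
move=> iN /and3P[nb1 nb0 ns] x xS; apply: eq_hill => l lN.
by rewrite dent_bump.
Qed.

(* The run on the image replays the original run, so it reveals which
   coordinates were bumped: hence [phi] below is injective on good parameters. *)
Lemma accept_hill_le_dent (N r i : nat) (hr : (depth_max N.+1 N.+1 < r)%N)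
    (t : qtree (3 ^ N.+1) r) : (i < N)%N ->
  (#|[set o : param N | qrun t (hill hr (height o))]| <=
   #|[set o : param N | qrun t (hill hr (dent i (height o)))]|
   + #|[set o : param N | ~~ good i hr t o]|)%N.
Proof.
move=> iN; set Y := [set o | _]; set Z := [set o | qrun _ _]; set B := [set o | ~~ _].
pose path (o : param N) := qpath t (hill hr (height o)).
pose phi (o : param N) : param N := bump i (path o) o.
have sub : Y \subset (Y :\: B) :|: B.
  by apply/subsetP => o oY; rewrite !inE in oY *; rewrite oY; case: good.
apply: leq_trans (subset_leq_card sub) _.
apply: leq_trans (leq_card_setU _ _) _; rewrite leq_add2r.
have inj : {in Y :\: B &, injective phi}.
  move=> o1 o2; rewrite !inE !negbK => /andP[g1 _] /andP[g2 _] e.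
  have p1 := eq_qpath (hill_bump iN g1); have p2 := eq_qpath (hill_bump iN g2).
  have ep : path o1 = path o2.
    by rewrite /path -p1 -p2 -/(path o1) -/(path o2) -/(phi o1) -/(phi o2) e.
  apply/ffunP => p; have : phi o1 p = phi o2 p by rewrite e.
  rewrite /phi /bump !ffunE -ep; case: hasP => // -[x xS /andP[_ /eqP ->]].
  have lt (o : param N) : good i hr t o -> x \in path o ->
      ((o (cell N.+1 i.+1 x)).+1 < N.+1)%N.
    by move=> /and3P[_ _ /hasPn ns] /ns; exact: ltn_ord_neq_max.
  move=> /(congr1 val) /=; rewrite !inordK ?lt -?ep // => -[] e'.
  exact: val_inj.
rewrite -(card_in_imset inj); apply: subset_leq_card.
apply/subsetP => _ /imsetP[o + ->]; rewrite !inE negbK => /andP[g yo].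
by rewrite (eq_qrun (hill_bump iN g)).
Qed.

(** * Counting bad levels and parameters *)

Lemma sum_mem_le_size (n : nat) (s : seq nat) :
  (\sum_(i < n) (val i \in s) <= size s)%N.
Proof.
rewrite -(big_mkord xpredT (fun i => nat_of_bool (i \in s))) -big_mkcond /=.
rewrite sum1_count -size_filter; apply: uniq_leq_size.
  by rewrite filter_uniq // /index_iota iota_uniq.
by move=> i; rewrite mem_filter => /andP[].
Qed.

(** A branching level [j] spoils only [i = j] and [i = j - 1], whence the factor 2. *)
Lemma sum_branching_le (n N q : nat) (S : seq 'I_n) : (size S <= q)%N ->
  (\sum_(i < N) (branching i.+1 S || branching i S) <= 2 * q)%N.
Proof.
move=> Sq; have [s szs Hs] := branch_levels (map val S); rewrite size_map in szs.
have br i : branching i S -> i \in s.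
  move=> /hasP[x xS /hasP[y yS b]].
  by apply: (Hs i x y) => //; apply: map_f.
apply: (@leq_trans (\sum_(i < N) ((val i \in map predn s) + (val i \in s)))).
  apply: leq_sum => i _.
  case b1 : (branching i.+1 S); last by case b0 : (branching i S); rewrite // (br _ b0) leq_addl.
  have -> : val i \in map predn s by apply/mapP; exists i.+1; [exact: br|].
  by rewrite leq_addr.
rewrite big_split /= mul2n -addnn leq_add //.
  by apply: leq_trans (sum_mem_le_size _ _) _; rewrite size_map (leq_trans szs).
by apply: leq_trans (sum_mem_le_size _ _) _; rewrite (leq_trans szs).
Qed.

(** A query reads a single cell of level [i.+1], so each of the [q] queries finds [ord_max] with
    probability at most [1 / N.+1]. *)
Lemma card_saturated (N r q i : nat) (hr : (depth_max N.+1 N.+1 < r)%N)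
    (t : qtree (3 ^ N.+1) r) : (i < N)%N -> qdepth_le t q ->
  (#|[set o : param N | saturated i (qpath t (hill hr (height o))) o]| * N.+1
   <= q * #|param N|)%N.
Proof.
move=> iN tq; rewrite -[X in (_ * X <= _)%N](card_ord N.+1).
apply: (card_qpath_hits (F := fun o : param N => hill hr (height o))
  (c := fun x => cell N.+1 i.+1 x)) => // o y v x nxy.
apply: eq_hill => l lN; rewrite /height ffunE.
have [->|nl] := eqVneq l i.+1; first by rewrite (negbTE nxy).
by rewrite (negbTE (cell_neq _ _ _ _ nl)) // ?ltnS; lia.
Qed.

Lemma accept_hill_bound (N r q : nat) (hr : (depth_max N.+1 N.+1 < r)%N)
    (t : qtree (3 ^ N.+1) r) : qdepth_le t q ->
  (N * #|[set o : param N | qrun t (hill hr (height o))]| <=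
   \sum_(i < N) #|[set o : param N | qrun t (hill hr (dent i (height o)))]|
   + 3 * q * #|param N|)%N.
Proof.
move=> tq.
pose path (o : param N) := qpath t (hill hr (height o)).
pose br i := [set o : param N | branching i.+1 (path o) || branching i (path o)].
pose sat i := [set o : param N | saturated i (path o) o].
have bad i : (#|[set o : param N | ~~ good i hr t o]| <= #|br i| + #|sat i|)%N.
  apply: leq_trans (leq_card_setU _ _); apply: subset_leq_card.
  by apply/subsetP => o; rewrite !inE /good !negb_and !negbK orbA.
(* Branching is bounded for each parameter separately, so the sum over levels is taken first. *)
have sum_br : (\sum_(i < N) #|br i| <= 2 * q * #|param N|)%N.
  under eq_bigr => i _ do
    rewrite -sum1_card (eq_bigl _ _ (in_set _)) big_mkcond /=.
  rewrite exchange_big /= mulnC -sum_nat_const; apply: leq_sum => o _.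
  apply: leq_trans (sum_branching_le N (size_qpath (hill hr (height o)) tq)).
  by apply: leq_sum => i _; exact: leqnn.
(* Each of the [N] levels loses at most a fraction [q / N.+1] of the parameters. *)
have sum_sat : (\sum_(i < N) #|sat i| <= q * #|param N|)%N.
  rewrite -(leq_pmul2r (ltn0Sn N)) big_distrl /=.
  apply: (@leq_trans (\sum_(i < N) q * #|param N|)).
    by apply: leq_sum => i _; exact: card_saturated.
  by rewrite sum_nat_const card_ord mulnC leq_mul2l leqnSn orbT.
rewrite -[N in (N * _)%N]card_ord -sum_nat_const.
apply: (@leq_trans (\sum_(i < N)
  (#|[set o : param N | qrun t (hill hr (dent i (height o)))]| + (#|br i| + #|sat i|)))).
  apply: leq_sum => i _.
  by apply: leq_trans (accept_hill_le_dent hr t (ltn_ord i)) _; rewrite leq_add2l bad.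
rewrite !big_split /= leq_add2l; apply: leq_trans (leq_add sum_br sum_sat) _.
by rewrite -mulnDl -mulSnr.
Qed.

(** * From decision trees to randomized testers *)

Lemma sum_accept_prob (n m : nat) (O : finType) (F : O -> 'I_n -> 'I_m)
    (T : rtester n m) :
  \sum_(o : O) accept_prob T (F o)
  = \sum_(a < rt_size T) rt_w T a * #|[set o | qrun (rt_alg T a) (F o)]|%:R.
Proof.
rewrite /accept_prob exchange_big /=; apply: eq_bigr => a _.
rewrite -mulr_sumr -natr_sum; congr (_ * _%:R).
rewrite -sum1_card (eq_bigl _ _ (in_set _)) [RHS]big_mkcond.
by apply: eq_bigr => o _; case: qrun.
Qed.

Lemma depth_max_range (N : nat) :
  (depth_max N.+1 N.+1 < (9 * N.+1) ^ (3 * N.+1))%N.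
Proof.
apply: leq_trans (depth_max_lt _ (ltn0Sn N)) _.
rewrite -expnMn -mulnA [(_ * 3)%N]mulnC mulnA leq_pexp2l //.
by rewrite leq_pmull.
Qed.

(** Averaged over parameters, hills are accepted with probability at least 2/3 and dented ones at
    most 1/3. Summed over [N] levels this gap is at most [3 * q] by [accept_hill_bound] on each
    tree, so [N / 3 <= 3 * q]. *)
Lemma queries_lower_bound (N q : nat)
    (T : rtester (3 ^ N.+1) ((9 * N.+1) ^ (3 * N.+1))) :
  is_convexity_tester (1 / 9) T -> makes_at_most T q -> (N <= 9 * q)%N.
Proof.
move=> [[w0 w1] [Tyes Tno]] Tq.
pose hr := depth_max_range N; pose P : R := #|param N|%:R.
have P0 : 0 < P.
  by rewrite ltr0n; apply/card_gt0P; exists [ffun=> ord0].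
have yes : 2 / 3 * P <= \sum_(o : param N) accept_prob T (hill hr (height o)).
  rewrite mulrC /P -sumr_const mulr_suml mul1r; apply: ler_sum => o _.
  by apply: Tyes; apply: convex_hill => //; exact: multiplier_height.
have no (i : 'I_N) :
    \sum_(o : param N) accept_prob T (hill hr (dent i (height o))) <= 1 / 3 * P.
  rewrite mulrC /P -sumr_const mulr_suml mul1r; apply: ler_sum => o _.
  have := Tno _ (far_dent (i := i) hr (ltn0Sn N) (multiplier_height o) (ltn_ord i)).
  by lra.
have key : N%:R * (2 / 3 * P) <= N%:R * (1 / 3 * P) + (3 * q)%N%:R * P.
  apply: (@le_trans _ _ (N%:R * \sum_(o : param N) accept_prob T (hill hr (height o)))).
    exact: ler_wpM2l.
  apply: (@le_trans _ _ (\sum_(i < N) \sum_(o : param N)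
      accept_prob T (hill hr (dent i (height o))) + (3 * q)%N%:R * P)); last first.
    rewrite lerD2r -[N in N%:R]card_ord -sumr_const mulr_suml mul1r.
    by apply: ler_sum => i _.
  rewrite sum_accept_prob mulr_sumr.
  under [X in _ <= X + _]eq_bigr => i _ do rewrite sum_accept_prob.
  have -> : (3 * q)%N%:R * P = \sum_(a < rt_size T) rt_w T a * ((3 * q)%N%:R * P).
    by rewrite -mulr_suml w1 mul1r.
  rewrite exchange_big /= -big_split /=.
  apply: ler_sum => a _.
  rewrite -mulr_sumr -mulrDr mulrCA ler_wpM2l //.
  rewrite -natr_sum -natrM -natrM -natrD ler_nat.
  exact: accept_hill_bound.
have : N%:R <= (9 * q)%N%:R :> R.
  by rewrite -(ler_pM2r P0) !natrM; move: key; rewrite !natrM; lra.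
by rewrite ler_nat.
Qed.

(** Covers [k = 1], where no level can be dented: without queries, zero and a spike at the middle
    point are accepted alike. *)
Lemma tester_queries_gt0 (q : nat) (T : rtester (3 ^ 1) ((9 * 1) ^ (3 * 1))) :
  is_convexity_tester (1 / 9) T -> makes_at_most T q -> (0 < q)%N.
Proof.
case: q => // -[[w0 w1] [Tyes Tno]] Tq.
have leaf f g : accept_prob T f = accept_prob T g.
  apply: eq_bigr => a _; congr (_ * _%:R).
  by have := Tq a; case: (rt_alg T a).
have r0 : (0 < (9 * 1) ^ (3 * 1))%N by [].
have r1 : (1 < (9 * 1) ^ (3 * 1))%N by [].
pose z (x : 'I_(3 ^ 1)) := Ordinal r0.
pose f (x : 'I_(3 ^ 1)) := if val x == 1%N then Ordinal r1 else Ordinal r0.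
have cz : convex_on (realf z).
  apply: (@convex_on_support _ _ (fun=> 0)) => x y.
  by rewrite mul0r addr0.
have ff : far_from_convex (1 / 9) (realf f).
  (* A ninth of three points is less than 1, so one changed point suffices. *)
  move=> h hc; apply: (@le_trans _ _ 1); first by rewrite expn1; lra.
  rewrite ler1n card_gt0; apply/set0Pn.
  pose a := @Ordinal (3 ^ 1) 0 isT; pose b := @Ordinal (3 ^ 1) 1 isT.
  pose c := @Ordinal (3 ^ 1) 2 isT.
  have := convex_on_midpoint (a := a) (b := b) (c := c) hc erefl.
  have [ea|na] := eqVneq (h a) (realf f a); last by exists a; rewrite inE.
  have [eb|nb] := eqVneq (h b) (realf f b); last by exists b; rewrite inE.
  have [ec|nc] := eqVneq (h c) (realf f c); last by exists c; rewrite inE.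
  by rewrite ea eb ec /realf /f /=; lra.
have := Tyes z cz; have := Tno f ff; rewrite (leaf f z); lra.
Qed.

Theorem theorem6p2 :
  exists c : R, 0 < c /\
    forall (k : nat), (0 < k)%N ->
    forall (q : nat) (T : rtester (3 ^ k) ((9 * k) ^ (3 * k))),
      is_convexity_tester (1 / 9) T ->
      makes_at_most T q ->
      c * k%:R <= q%:R.
Proof.
(* For [k = N.+1] with [N] positive, [N.+1 <= 2 * N <= 18 * q]; for [k = 1], [q] is positive. *)
exists (1 / 18); split; first lra.
move=> [//|N] _ q T Tt Tq.
suff : (N.+1 <= 18 * q)%N by rewrite -(ler_nat R) natrM; lra.
have NT := queries_lower_bound Tt Tq.
case: N T Tt Tq NT => [|N] T Tt Tq NT; last lia.
by have := tester_queries_gt0 Tt Tq; lia.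
Qed.
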